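(* Let $\ell=h-\tilde h$ be a symmetric and split quantum field associated with $\widehat{\mathcal M}$, with splitting fields $h,\tilde h$ and splitting domain $\mathcal D_{\mathsf{split}}$. Let $f\in C_c^\infty(\mathfrak M)$ be real-valued, and suppose that $\Omega\in\mathcal D_{\mathsf{split}}$. Let $\mathcal D\subset\mathcal H$ be a dense linear subspace with $\mathcal D\subset\mathcal D_{\mathsf{split}}\cap\mathcal S_{\mathsf{affil}}(\tilde h(f))$. Then $\ell(f)$, as a sesquilinear form on $\mathcal D\times\mathcal D$, fulfills a nontrivial quantum $L^4(\mathcal M(\mathfrak M),\Omega)$ inequality if and only if $h(f)$, as a sesquilinear form on $\mathcal D\times\mathcal D$, does.
   Context: **Thermal setting.** $\mathfrak M$ is a static globally hyperbolic spacetime with a Cauchy surface $\mathfrak C$ and the flow $\Xi_t$ of a timelike Killing vector orthogonal to $\mathfrak C$. Regions $\mathcal O\subset\mathfrak M$ are open; $\mathcal O'$ is the interior of the causal complement. $\mathcal O\mapsto\mathcal A(\mathcal O)$ is a net of $C^*$-algebras which is isotonous, local ($[\mathcal A(\mathcal O),\mathcal A(\mathcal O')]=\{0\}$), inner regular ($\mathcal A(\mathcal O)$ is the norm closure of the union of $\mathcal A(\mathcal O_1)$ over $\mathcal O_1$ contained in a compact subset of $\mathcal O$), and covariant under a one-parameter group $\alpha_t$ of automorphisms of $\mathcal A(\mathfrak M)$: $\alpha_t(\mathcal A(\mathcal O))=\mathcal A(\Xi_t\mathcal O)$. $\omega$ is an $\alpha$-invariant state that is KMS at inverse temperature $0<\beta<\infty$,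 i.e. $\omega(A\alpha_{t+i\beta}(B))=\omega(\alpha_t(B)A)$ in the sense of boundary values of a bounded continuous function on the strip $0\le\operatorname{Im}z\le\beta$, analytic in the interior. $(\mathcal H,\pi,\Omega)$ is its GNS representation, $U(t)$ the implementing unitary group ($U(t)\pi(A)U(t)^*=\pi(\alpha_t(A))$, $U(t)\Omega=\Omega$), assumed strongly continuous, $U(t)=e^{iLt}$. Set $\mathcal M(\mathcal O)=\pi(\mathcal A(\mathcal O))''$. $\Omega$ is cyclic and separating for $\mathcal M(\mathfrak M)$; $\Delta,J$ are the Tomita–Takesaki modular objects of $(\mathcal M(\mathfrak M),\Omega)$. $\tilde{\mathcal M}(\mathcal O)=J\mathcal M(\mathcal O)J$, $\widehat{\mathcal M}(\mathcal O)=\mathcal M(\mathcal O)\vee\tilde{\mathcal M}(\mathcal O)$. One has $\tilde{\mathcal M}(\mathfrak M)=\mathcal M(\mathfrak M)'$. **Affiliation.** A densely defined closed operator $T$ is affiliated with a von Neumann algebra $\mathcal N$ ($T\mathrel{\eta}\mathcal N$) if for all $A\in\mathcal N'$: $A\operatorname{dom}T\subset\operatorname{dom}T$ and $AT\psi=TA\psi$ for $\psi\in\operatorname{dom}T$. **Quantum fields.** For an isotonous $U$-covariant net $\mathcal N$ of von Neumann algebras on $\mathcal H$, a quantum field $\phi$ associated with $\mathcal N$ is a complex-linear map assigning to every $f\in C_c^\infty(\mathfrak M)$ a densely defined closed operator $\phi(f)$ on $\mathcal H$, with $\phi(f)\mathrel{\eta}\mathcal N(\mathcal O')'\cap\mathcal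 N(\mathfrak M)$ whenever $\operatorname{supp}f\subset\mathcal O$. Complex-linear means $\phi(\lambda f+g)=\lambda\phi(f)+\phi(g)$ on a common core for all three operators. $\phi$ is symmetric if $\phi(f)$ is symmetric for real-valued $f$. A symmetric quantum field $\ell$ associated with $\widehat{\mathcal M}$ is split if there are symmetric quantum fields $h,\tilde h$ associated with $\mathcal M,\tilde{\mathcal M}$ respectively, and a dense subspace $\mathcal D_{\mathsf{split}}\subset\mathcal H$ with $\mathcal D_{\mathsf{split}}\subset\operatorname{dom}\ell(f)\cap\operatorname{dom}h(f)\cap\operatorname{dom}\tilde h(f)$ for all $f$, such that $(\psi,\ell(f)\psi)=(\psi,h(f)\psi)-(\psi,\tilde h(f)\psi)$ for all $f\in C_c^\infty(\mathfrak M)$, $\psi\in\mathcal D_{\mathsf{split}}$. **The set $\mathcal S_{\mathsf{affil}}$.** $\mathcal S_{\mathsf{affil}}(T')=\{A\Omega: A\mathrel{\eta}\mathcal M(\mathfrak M),\ \Omega\in\operatorname{dom}(A^*A),\ A\Omega\in\operatorname{dom}T'\}$. It is contained in $L^4(\mathcal M(\mathfrak M),\Omega)$ when $T'$ is a densely defined closed symmetric operator affiliated with $\mathcal M(\mathfrak M)'$ and $\Omega\in\operatorname{dom}T'$. **$L^4$ space.** For a von Neumann algebra $\mathcal M$ on $\mathcal H$ with cyclic separating unit vector $\Omega$ and modular operator $\Delta$, $L^4(\mathcal M,\Omega)$ is the completion of $\mathcal M\Omega$ in the norm $\|A\Omega\|_4=\|\Delta^{1/4}A^*A\Omega\|^{1/2}$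 ($A\in\mathcal M$). The inclusion $\mathcal M\Omega\to\mathcal H$ extends to a continuous injection, by which $L^4(\mathcal M,\Omega)$ is regarded as a subspace of $\mathcal H$. **Quantum inequality.** Let $\mathcal B\subset\mathcal H$ be a densely and continuously embedded Banach space and $T$ a hermitean sesquilinear form on $\mathcal D\times\mathcal D$, with $\mathcal D\subset\mathcal B$ a linear subspace dense in $\mathcal H$. $T$ is $\mathcal B$-bounded below (above) if there is $c\in\mathbb R$ with $(\psi,T\psi)\ge c\|\psi\|_{\mathcal B}^2$ (resp. $\le$) for all $\psi\in\mathcal D$. $T$ fulfills a nontrivial quantum $\mathcal B$-inequality if it is $\mathcal B$-bounded below but not $\mathcal B$-bounded above. *)

(* Defs.v *)
From HB Require Import structures.
From mathcomp Require Import all_boot all_order all_algebra.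
From mathcomp Require Import sesquilinear complex.
From mathcomp Require Import all_classical all_reals all_analysis.

Set Implicit Arguments.
Unset Strict Implicit.
Unset Printing Implicit Defensive.

Import Order.TTheory GRing.Theory Num.Theory.
Import numFieldNormedType.Exports.

Local Open Scope classical_set_scope.
Local Open Scope ring_scope.
Local Open Scope complex_scope.

Section Smooth.
Context {R : realType}.

(* [V] is always finite dimensional below, so that C^k is equivalent to the
   existence and continuity of all iterated directional derivatives. *)
Fixpoint Ck_on (k : nat) (V W : normedModType R) (U : set V) (f : V -> W)
    : Prop :=
  match k with
  | 0 => forall x, U x -> {for x, continuous f}
  | k'.+1 => forall v, (forall x, U x -> derivable f x v) /\
                       Ck_on k' U (fun x => 'D_v f x)
  end.

Definition smooth_on (V W : normedModType R) (U : set V) (f : V -> W) : Prop :=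
  forall k, Ck_on k U f.

(* Only the values of [cmap] on [cdom], and those of [cinv] on
   [cmap @` cdom], are meaningful. *)
Record chart (d : nat) (M : Type) := Chart {
  cdom : set M;
  cmap : M -> 'rV[R]_d;
  cinv : 'rV[R]_d -> M }.

Definition cim d (M : Type) (c : chart d M) : set 'rV[R]_d := cmap c @` cdom c.

Definition is_chart d (M : topologicalType) (c : chart d M) : Prop :=
  [/\ open (cdom c), open (cim c),
      (forall p, cdom c p -> cinv c (cmap c p) = p),
      (forall p, cdom c p -> {for p, continuous (cmap c)}) &
      (forall x, cim c x -> {for x, continuous (cinv c)})].

Definition smooth_map d (M : Type) (atl : set (chart d M)) (F : M -> M) : Prop :=
  forall c c', atl c -> atl c' ->
    smooth_on (cmap c @` (cdom c `&` F @^-1` cdom c'))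
              (cmap c' \o F \o cinv c).

Definition is_atlas d (M : topologicalType) (atl : set (chart d M)) : Prop :=
  [/\ (forall c, atl c -> is_chart c),
      (forall p, exists2 c, atl c & cdom c p) &
      smooth_map atl id].

Definition smooth_fun d (M : Type) (atl : set (chart d M)) (u : M -> R) : Prop :=
  forall c, atl c -> smooth_on (cim c) (u \o cinv c).

(* A metric is given by its matrix [g c p] at each point [p] in each chart
   [c]; tangent vectors at [p] are row vectors of components in [c]. *)
Definition metric_field d (M : Type) := chart d M -> M -> 'M[R]_d.

Definition gdot d (M : Type) (g : metric_field d M) c p (v w : 'rV[R]_d) : R :=
  (v *m g c p *m w^T) 0 0.

(* F^* g = g.  With row vectors the differential is [v |-> v *m 'J f x]. *)
Definition preserves_metric d (M : Type) (atl : set (chart d M))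
    (g : metric_field d M) (F : M -> M) : Prop :=
  forall c c' p, atl c -> atl c' -> cdom c p -> cdom c' (F p) ->
    let J := 'J (cmap c' \o F \o cinv c) (cmap c p) in
    g c p = J *m g c' (F p) *m J^T.

(* Signature (-,+,...,+); [preserves_metric atl g id] is the tensorial
   transformation law under changes of charts. *)
Definition lorentzian_metric n (M : Type) (atl : set (chart n.+1 M))
    (g : metric_field n.+1 M) : Prop :=
  [/\ (forall c, atl c -> smooth_on (cim c) (fun x => g c (cinv c x))),
      preserves_metric atl g id,
      (forall c p, atl c -> cdom c p -> (g c p)^T = g c p) &
      (forall c p, atl c -> cdom c p -> exists2 P : 'M[R]_n.+1, P \in unitmx &
         P *m g c p *m P^T =
         diag_mx (\row_(i < n.+1) (if i == ord0 then -1 else 1)))].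

Definition velocity d (M : Type) (c : chart d M) (gam : R -> M) (t : R)
    : 'rV[R]_d :=
  derive1 (cmap c \o gam) t.

(* Curves are parametrized by the whole of R.  This loses no generality:
   any open interval is diffeomorphic to R, and a causal (timelike) curve
   segment extends beyond its end points. *)
Definition C1_curve d (M : topologicalType) (atl : set (chart d M))
    (gam : R -> M) : Prop :=
  continuous gam /\
  forall c t, atl c -> cdom c (gam t) ->
    derivable (cmap c \o gam) t 1 /\ {for t, continuous (velocity c gam)}.

Definition causal_curve d (M : topologicalType) (atl : set (chart d M))
    (g : metric_field d M) (gam : R -> M) : Prop :=
  C1_curve atl gam /\
  forall c t, atl c -> cdom c (gam t) ->
    velocity c gam t != 0 /\
    gdot g c (gam t) (velocity c gam t) (velocity c gam t) <= 0.

Definition timelike_curve d (M : topologicalType) (atl : set (chart d M))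
    (g : metric_field d M) (gam : R -> M) : Prop :=
  C1_curve atl gam /\
  forall c t, atl c -> cdom c (gam t) ->
    gdot g c (gam t) (velocity c gam t) (velocity c gam t) < 0.

Definition inextendible (M : topologicalType) (gam : R -> M) : Prop :=
  forall q : M, ~ (gam x @[x --> +oo] --> q) /\ ~ (gam x @[x --> -oo] --> q).

Definition meets_inextendible_once d (M : topologicalType)
    (atl : set (chart d M)) (g : metric_field d M) (C : set M) : Prop :=
  forall gam, timelike_curve atl g gam -> inextendible gam ->
    exists! t, C (gam t).

(* Components at [p], in the chart [c], of the generator of the flow [Xi]. *)
Definition generator d (M : Type) (Xi : R -> M -> M) (c : chart d M) (p : M)
    : 'rV[R]_d :=
  velocity c (Xi^~ p) 0.

Definition smooth_flow d (M : topologicalType) (atl : set (chart d M))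
    (Xi : R -> M -> M) : Prop :=
  [/\ (forall p, Xi 0 p = p),
      (forall s t p, Xi (s + t) p = Xi s (Xi t p)),
      continuous (fun tp : R * M => Xi tp.1 tp.2) &
      (forall c c', atl c -> atl c' ->
         smooth_on [set tx : R * 'rV[R]_d | cim c tx.2 /\
                      cdom c' (Xi tx.1 (cinv c tx.2))]
                   (fun tx : R * 'rV[R]_d => cmap c' (Xi tx.1 (cinv c tx.2))))].

(* [C] is a smooth embedded hypersurface: near each of its points it is the
   zero set of a smooth [F] with nonvanishing differential.  The kernel of that
   differential is the tangent space of [C], to which [Xi]'s generator is
   orthogonal. *)
Definition hypersurface_orthogonal d (M : topologicalType)
    (atl : set (chart d M)) (g : metric_field d M) (Xi : R -> M -> M)
    (C : set M) : Prop :=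
  forall p, C p -> exists (c : chart d M) (V : set M) (F : 'rV[R]_d -> R),
    [/\ atl c, open V, V p & V `<=` cdom c] /\
    [/\ smooth_on (cmap c @` V) F,
        (forall q, V q -> C q <-> F (cmap c q) = 0),
        (exists v, 'D_v F (cmap c p) <> 0) &
        (forall v, 'D_v F (cmap c p) = 0 ->
           gdot g c p v (generator Xi c p) = 0)].

(* Static globally hyperbolic spacetimes of dimension n + 1.  Global
   hyperbolicity is the existence of a Cauchy surface; a complete Killing field
   is a complete field whose flow consists of isometries. *)
Record static_spacetime (n : nat) (M : topologicalType) := StaticSpacetime {
  atlas : set (chart n.+1 M);
  metric : metric_field n.+1 M;
  flow : R -> M -> M;
  cauchy_surface : set M;
  spacetime_hausdorff : hausdorff_space M;
  spacetime_second_countable : @second_countable M;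
  atlasP : is_atlas atlas;
  metricP : lorentzian_metric atlas metric;
  flowP : smooth_flow atlas flow;
  flow_killing : forall t, preserves_metric atlas metric (flow t);
  flow_timelike : forall c p, atlas c -> cdom c p ->
    gdot metric c p (generator flow c p) (generator flow c p) < 0;
  cauchy_surfaceP : meets_inextendible_once atlas metric cauchy_surface;
  flow_orthogonal : hypersurface_orthogonal atlas metric flow cauchy_surface }.

(* The definition is symmetric in [p] and [q], so that it describes
   the union of the causal future and the causal past. *)
Definition causally_related n (M : topologicalType) (X : static_spacetime n M)
    (p q : M) : Prop :=
  exists gam : R -> M, causal_curve (atlas X) (metric X) gam /\
    exists s t, gam s = p /\ gam t = q.

Definition causal_complement n (M : topologicalType) (X : static_spacetime n M)
    (O : set M) : set M :=
  interior [set q | forall p, O p -> ~ causally_related X p q].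

Definition supp (M : topologicalType) (f : M -> R[i]) : set M :=
  closure [set p | f p != 0].

Definition test_function n (M : topologicalType) (X : static_spacetime n M)
    (f : M -> R[i]) : Prop :=
  [/\ smooth_fun (atlas X) (fun p => complex.Re (f p)),
      smooth_fun (atlas X) (fun p => complex.Im (f p)) &
      compact (supp f)].

End Smooth.

(* The library's sesquilinear forms are linear in the first argument. *)
HB.mixin Record isHilbert (R : realType) H of CompleteNormedModule R[i] H := {
  hdot : {dot H for Num.conj};
  hdot_norm : forall x : H, `|x| ^+ 2 = hdot x x }.

#[short(type="hilbertType")]
HB.structure Definition Hilbert (R : realType) :=
  {H of isHilbert R H & CompleteNormedModule R[i] H}.

(* inner product, linear in the second argument *)
Definition ip (R : realType) (H : hilbertType R) (x y : H) : R[i] :=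
  (hdot : {dot H for Num.conj}) y x.

(* A C*-algebra is not required to have a unit. *)
HB.mixin Record isCStar (R : realType) A of CompleteNormedModule R[i] A := {
  cmul : A -> A -> A;
  cstar : A -> A;
  cmulA : associative cmul;
  cmul_linearl : forall y : A, linear (cmul^~ y);
  cmul_linearr : forall x : A, linear (cmul x);
  cmul_norm : forall x y : A, `|cmul x y| <= `|x| * `|y|;
  cstarK : involutive cstar;
  cstar_antilinear : forall (a : R[i]) (x y : A),
    cstar (a *: x + y) = a^* *: cstar x + cstar y;
  cstarM : forall x y : A, cstar (cmul x y) = cmul (cstar y) (cstar x);
  cstar_norm : forall x : A, `|cmul (cstar x) x| = `|x| ^+ 2 }.

#[short(type="cstarType")]
HB.structure Definition CStar (R : realType) :=
  {A of isCStar R A & CompleteNormedModule R[i] A}.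

Section Operators.
Context {R : realType} {H : hilbertType R}.

(* The values of [T] outside [dom T] are meaningless. *)
Record operator := Operator { dom : set H; app :> H -> H }.

Definition subspace_of (D : set H) : Prop :=
  D 0 /\ forall (a : R[i]) x y, D x -> D y -> D (a *: x + y).

Definition graph (T : operator) : set (H * H) :=
  [set p | dom T p.1 /\ p.2 = T p.1].

Definition restrict (T : operator) (D : set H) : operator := Operator D T.

Definition compose (S T : operator) : operator :=
  Operator [set x | dom T x /\ dom S (T x)] (S \o T).

Definition linear_operator (T : operator) : Prop :=
  subspace_of (dom T) /\
  forall (a : R[i]) x y, dom T x -> dom T y -> T (a *: x + y) = a *: T x + T y.

Definition densely_defined_closed (T : operator) : Prop :=
  [/\ linear_operator T, dense (dom T) & closed (graph T)].

Definition symmetric_operator (T : operator) : Prop :=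
  forall x y, dom T x -> dom T y -> ip x (T y) = ip (T x) y.

Definition adjoint (T : operator) : operator :=
  Operator [set x | exists z, forall y, dom T y -> ip x (T y) = ip z y]
           (fun x => get [set z | forall y, dom T y -> ip x (T y) = ip z y]).

Definition core (T : operator) (D : set H) : Prop :=
  [/\ subspace_of D, D `<=` dom T & graph T `<=` closure (graph (restrict T D))].

Definition positive_selfadjoint (T : operator) : Prop :=
  [/\ linear_operator T, dense (dom T), graph (adjoint T) = graph T &
      forall x, dom T x -> 0 <= ip x (T x)].

(* Q = T^(1/2) *)
Definition positive_sqrt (T Q : operator) : Prop :=
  positive_selfadjoint Q /\ graph (compose Q Q) = graph T.

Definition bounded_operator (A : H -> H) : Prop := linear A /\ continuous A.

Definition badj (A : H -> H) : H -> H := adjoint (Operator setT A).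

Definition commutant (N : set (H -> H)) : set (H -> H) :=
  [set B | bounded_operator B /\ forall A, N A -> A \o B = B \o A].

Definition vN_generated (N : set (H -> H)) : set (H -> H) :=
  commutant (commutant N).

Definition vN_algebra (N : set (H -> H)) : Prop :=
  (forall A, N A -> N (badj A)) /\ vN_generated N = N.

Definition cyclic_vector (N : set (H -> H)) (Omega : H) : Prop :=
  dense [set A Omega | A in N].

Definition separating_vector (N : set (H -> H)) (Omega : H) : Prop :=
  forall A, N A -> A Omega = 0 -> A = cst 0.

Definition affiliated (T : operator) (N : set (H -> H)) : Prop :=
  densely_defined_closed T /\
  forall A, commutant N A -> forall x, dom T x ->
    dom T (A x) /\ A (T x) = T (A x).

Definition antiunitary_involution (J : H -> H) : Prop :=
  [/\ (forall (a : R[i]) x y, J (a *: x + y) = a^* *: J x + J y),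
      (forall x y, ip (J x) (J y) = ip y x) &
      (forall x, J (J x) = x)].

(* graph of the Tomita operator: the closure of A Omega |-> A^* Omega *)
Definition tomita_graph (N : set (H -> H)) (Omega : H) : set (H * H) :=
  closure [set (A Omega, badj A Omega) | A in N].

(* The polar decomposition S = J Delta^(1/2) of the Tomita operator;
   D2 = Delta^(1/2) and D4 = Delta^(1/4) are obtained as iterated
   positive square roots, which determines them. *)
Definition modular_objects (N : set (H -> H)) (Omega : H)
    (J : H -> H) (Delta D2 D4 : operator) : Prop :=
  [/\ antiunitary_involution J, positive_selfadjoint Delta,
      positive_sqrt Delta D2, positive_sqrt D2 D4 &
      tomita_graph N Omega = graph (compose (Operator setT J) D2)].

(* ||A Omega||_4 = ||Delta^(1/4) A^* A Omega||^(1/2) *)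
Definition L4pre (Omega : H) (D4 : operator) (A : H -> H) : R :=
  Num.sqrt (complex.Re `|D4 (badj A (A Omega))|).

(* The completion of [N Omega], seen inside [H]: [x] is the limit in [H] of an
   L^4-Cauchy sequence (A_n Omega), and [r] is the limit of its L^4 norms. *)
Definition L4_limit (N : set (H -> H)) (Omega : H) (D4 : operator)
    (x : H) (r : R) : Prop :=
  exists A : nat -> H -> H,
    [/\ (forall m, N (A m)),
        (forall e : R, 0 < e -> exists m0, forall m k, (m0 <= m)%N ->
           (m0 <= k)%N -> L4pre Omega D4 (A m \- A k) < e),
        A m Omega @[m --> \oo] --> x &
        L4pre Omega D4 (A m) @[m --> \oo] --> r].

Definition L4 (N : set (H -> H)) (Omega : H) (D4 : operator) : set H :=
  [set x | exists r, L4_limit N Omega D4 x r].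

Definition L4norm (N : set (H -> H)) (Omega : H) (D4 : operator) (x : H) : R :=
  get [set r | L4_limit N Omega D4 x r].

Definition form_of (T : operator) : H -> H -> R[i] := fun x y => ip x (T y).

(* [B] is the Banach space, with norm [nB], and [D] is contained in [B].  The
   inequalities are those of R[i], which entail that both sides are real. *)
Definition bounded_below (nB : H -> R) (D : set H) (T : H -> H -> R[i]) : Prop :=
  exists c : R, forall x, D x -> (c * nB x ^+ 2)%:C <= T x x.

Definition bounded_above (nB : H -> R) (D : set H) (T : H -> H -> R[i]) : Prop :=
  exists c : R, forall x, D x -> T x x <= (c * nB x ^+ 2)%:C.

Definition nontrivial_QI (B : set H) (nB : H -> R) (D : set H)
    (T : H -> H -> R[i]) : Prop :=
  [/\ D `<=` B, bounded_below nB D T & ~ bounded_above nB D T].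

Definition S_affil (N : set (H -> H)) (Omega : H) (T' : operator) : set H :=
  [set x | exists A : operator,
     [/\ affiliated A N, dom (compose (adjoint A) A) Omega,
         dom T' (A Omega) & x = A Omega]].

Definition unitary_group (U : R -> H -> H) : Prop :=
  [/\ (forall t, bounded_operator (U t)),
      (forall t x y, ip (U t x) (U t y) = ip x y),
      U 0 = id,
      (forall s t, U (s + t) = U s \o U t) &
      (forall x, continuous (U^~ x))].

End Operators.

Arguments operator {R} H.

Section Nets.
Context {R : realType} {n : nat} {M : topologicalType}.
Variable X : @static_spacetime R n M.

Definition cstar_subalgebra (A : cstarType R) (B : set A) : Prop :=
  [/\ B 0, (forall (a : R[i]) x y, B x -> B y -> B (a *: x + y)),
      (forall x y, B x -> B y -> B (cmul x y)),
      (forall x, B x -> B (cstar x)) & closed B].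

(* [A] is the global algebra, the algebra of the whole spacetime. *)
Definition cstar_net (A : cstarType R) (net : set M -> set A) : Prop :=
  [/\ (forall O, open O -> cstar_subalgebra (net O)), net setT = setT,
      (forall O1 O2, open O1 -> open O2 -> O1 `<=` O2 -> net O1 `<=` net O2),
      (forall O, open O -> forall a b, net O a ->
         net (causal_complement X O) b -> cmul a b = cmul b a) &
      (forall O, open O -> net O = closure [set a | exists O1 K,
         [/\ open O1, compact K, O1 `<=` K, K `<=` O & net O1 a]])].

Definition automorphism_group (A : cstarType R) (alpha : R -> A -> A) : Prop :=
  [/\ (forall t, linear (alpha t)),
      (forall t a b, alpha t (cmul a b) = cmul (alpha t a) (alpha t b)),
      (forall t a, alpha t (cstar a) = cstar (alpha t a)),
      alpha 0 = id &
      (forall s t, alpha (s + t) = alpha s \o alpha t)].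

Definition is_state (A : cstarType R) (omega : A -> R[i]) : Prop :=
  [/\ scalar omega, (forall a, 0 <= omega (cmul (cstar a) a)),
      (forall a, `|omega a| <= `|a|) &
      (forall e : R, 0 < e -> exists2 a, `|a| <= 1 & 1 - e%:C < `|omega a|)].

Definition is_KMS (A : cstarType R) (alpha : R -> A -> A) (beta : R)
    (omega : A -> R[i]) : Prop :=
  let strip := [set z : R[i]^o | 0 <= complex.Im z <= beta] in
  forall a b : A, exists F : R[i]^o -> R[i]^o,
    [/\ {within strip, continuous F},
        (exists K : R, forall z, strip z -> `|F z| <= K%:C),
        (forall z, 0 < complex.Im z < beta -> derivable F z 1),
        (forall t : R, F (t +i* 0) = omega (cmul a (alpha t b))) &
        (forall t : R, F (t +i* beta) = omega (cmul (alpha t b) a))].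

Definition GNS_representation (A : cstarType R) (omega : A -> R[i])
    (H : hilbertType R) (pi : A -> H -> H) (Omega : H) : Prop :=
  [/\ (forall a, bounded_operator (pi a)),
      (forall (c : R[i]) a b x, pi (c *: a + b) x = c *: pi a x + pi b x),
      (forall a b, pi (cmul a b) = pi a \o pi b) &
      (forall a x y, ip x (pi (cstar a) y) = ip (pi a x) y)] /\
  [/\ `|Omega| = 1, dense [set pi a Omega | a in setT] &
      (forall a, omega a = ip Omega (pi a Omega))].

Section Fields.
Variable H : hilbertType R.

Definition vN_net (U : R -> H -> H) (N : set M -> set (H -> H)) : Prop :=
  [/\ (forall O, open O -> vN_algebra (N O)),
      (forall O1 O2, open O1 -> open O2 -> O1 `<=` O2 -> N O1 `<=` N O2) &
      (forall O t, open O ->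
         [set U t \o A \o badj (U t) | A in N O] = N (flow X t @` O))].

(* Fields are functions on all of [M -> R[i]]; only their values on test
   functions are meaningful. *)
Definition quantum_field (U : R -> H -> H) (N : set M -> set (H -> H))
    (phi : (M -> R[i]) -> operator H) : Prop :=
  [/\ vN_net U N,
      (forall f, test_function X f -> densely_defined_closed (phi f)),
      (forall (a : R[i]) f g, test_function X f -> test_function X g ->
         let fg := fun p => a * f p + g p in
         exists D : set H,
           [/\ core (phi fg) D, core (phi f) D, core (phi g) D &
               forall x, D x -> phi fg x = a *: phi f x + phi g x]) &
      (forall f O, test_function X f -> open O -> supp f `<=` O ->
         affiliated (phi f)
           (commutant (N (causal_complement X O)) `&` N setT))].

Definition real_valued (f : M -> R[i]) : Prop :=
  forall p, f p \is Num.real.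

Definition symmetric_field (phi : (M -> R[i]) -> operator H) : Prop :=
  forall f, test_function X f -> real_valued f -> symmetric_operator (phi f).

End Fields.

(* [A] is the algebra of the whole spacetime and [gns] its representation.  The
   last field is Tomita's theorem for the global algebra. *)
Record thermal_setting (A : cstarType R) (H : hilbertType R) := ThermalSetting {
  net : set M -> set A;
  alpha : R -> A -> A;
  beta : R;
  omega : A -> R[i];
  gns : A -> H -> H;
  Omega : H;
  U : R -> H -> H;
  J : H -> H;
  Delta : operator H;
  Delta_half : operator H;
  Delta_quarter : operator H;
  netP : cstar_net net;
  alphaP : automorphism_group alpha;
  alpha_covariant : forall O t, open O ->
    alpha t @` net O = net (flow X t @` O);
  omega_state : is_state omega;
  omega_invariant : forall t a, omega (alpha t a) = omega a;
  beta_gt0 : 0 < beta;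
  omega_KMS : is_KMS alpha beta omega;
  gnsP : GNS_representation omega gns Omega;
  UP : unitary_group U;
  U_gns : forall t a, U t \o gns a \o badj (U t) = gns (alpha t a);
  U_Omega : forall t, U t Omega = Omega;
  Omega_cyclic : cyclic_vector (vN_generated (gns @` net setT)) Omega;
  Omega_separating : separating_vector (vN_generated (gns @` net setT)) Omega;
  modularP : modular_objects (vN_generated (gns @` net setT)) Omega
               J Delta Delta_half Delta_quarter;
  tomita : [set J \o B \o J | B in vN_generated (gns @` net setT)] =
           commutant (vN_generated (gns @` net setT)) }.

Section Local.
Variables (A : cstarType R) (H : hilbertType R) (T : thermal_setting A H).

Definition vN (O : set M) : set (H -> H) := vN_generated (gns T @` net T O).

Definition vN_tilde (O : set M) : set (H -> H) :=
  [set J T \o B \o J T | B in vN O].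

Definition vN_hat (O : set M) : set (H -> H) :=
  vN_generated (vN O `|` vN_tilde O).

Definition symmetric_quantum_field (N : set M -> set (H -> H))
    (phi : (M -> R[i]) -> operator H) : Prop :=
  quantum_field (U T) N phi /\ symmetric_field phi.

(* l = h - ht on Dsplit *)
Definition split_field (l h ht : (M -> R[i]) -> operator H) (Dsplit : set H)
    : Prop :=
  [/\ symmetric_quantum_field vN_hat l, symmetric_quantum_field vN h &
      symmetric_quantum_field vN_tilde ht] /\
  [/\ subspace_of Dsplit, dense Dsplit,
      (forall f, test_function X f ->
         Dsplit `<=` dom (l f) `&` dom (h f) `&` dom (ht f)) &
      (forall f x, test_function X f -> Dsplit x ->
         ip x (l f x) = ip x (h f x) - ip x (ht f x))].

Definition nontrivial_L4_QI (D : set H) (F : operator H) : Prop :=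
  nontrivial_QI (L4 (vN setT) (Omega T) (Delta_quarter T))
    (L4norm (vN setT) (Omega T) (Delta_quarter T)) D (form_of F).

End Local.
End Nets.

(* Main.v *)
From HB Require Import structures.
Require Import Defs.
From mathcomp Require Import all_boot all_order all_algebra.
From mathcomp Require Import sesquilinear complex.
From mathcomp Require Import all_classical all_reals all_analysis.
From mathcomp Require Import ring.

Set Implicit Arguments.
Unset Strict Implicit.
Unset Printing Implicit Defensive.

Import Order.TTheory GRing.Theory Num.Theory.
Import numFieldNormedType.Exports.
Local Open Scope classical_set_scope.
Local Open Scope ring_scope.

(* The two forms differ on D by that of T = ht f, so it suffices that T is
   L^4-bounded: |(x, T x)| <= c ||x||_4^2.  Let N be the global von Neumann
   algebra.  As T is affiliated with the commutant of N and symmetric,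
   v = T Omega satisfies (v, A Omega) = (A^* Omega, v) for A in N, hence
   v = Delta^(1/2) J v = Delta^(1/4) eta.  Therefore (B Omega, T C Omega) =
   (C^* B Omega, v) = (Delta^(1/4) C^* B Omega, eta) is at most
   ||eta|| ||B||_4 ||C||_4 by a Hoelder inequality that follows from Tomita's
   theorem, and the bound passes to L^4-limits lying in dom T. *)

(** * Inner-product algebra and the Cauchy-Schwarz inequality *)

Section InnerProduct.
Context {R : realType} {H : hilbertType R}.
Implicit Types (x y z : H) (a : R[i]).

Lemma ip_hermitian x y : ip x y = (ip y x)^*.
Proof. by rewrite /ip hermC /= expr0 mul1r. Qed.

Lemma ipDr x y z : ip x (y + z) = ip x y + ip x z.
Proof. by rewrite /ip linearDl. Qed.

Lemma ipZr a x y : ip x (a *: y) = a * ip x y.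
Proof. by rewrite /ip linearZl_LR. Qed.

Lemma ip0r x : ip x 0 = 0.
Proof. by rewrite /ip linear0l. Qed.

Lemma ipNr x y : ip x (- y) = - ip x y.
Proof. by rewrite -scaleN1r ipZr mulN1r. Qed.

Lemma ipBr x y z : ip x (y - z) = ip x y - ip x z.
Proof. by rewrite ipDr ipNr. Qed.

Lemma ipDl x y z : ip (x + y) z = ip x z + ip y z.
Proof. by rewrite /ip linearDr. Qed.

Lemma ipNl x y : ip (- x) y = - ip x y.
Proof. by rewrite /ip linearNr. Qed.

Lemma ipBl x y z : ip (x - y) z = ip x z - ip y z.
Proof. by rewrite ipDl ipNl. Qed.

Lemma ipZl a x y : ip (a *: x) y = a^* * ip x y.
Proof. by rewrite /ip linearZr. Qed.

Lemma ip0l x : ip 0 x = 0.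
Proof. by rewrite /ip linear0r. Qed.

Lemma ip_norm x : ip x x = `|x| ^+ 2.
Proof. by rewrite /ip hdot_norm. Qed.

Lemma ip_ext x y : (forall z, ip x z = ip y z) -> x = y.
Proof.
move=> E; apply/subr0_eq/normr0_eq0/eqP; rewrite -sqrf_eq0 -ip_norm.
by rewrite ipBl E subrr.
Qed.

(** Follows from positivity of the squared norm of [u], the component of [x] orthogonal to [y]. *)
Lemma cauchy_schwarz x y : `|ip x y| <= `|x| * `|y|.
Proof.
have [->|y0] := eqVneq y 0; first by rewrite ip0r !normr0 mulr0.
have ny : 0 < `|y| ^+ 2 by rewrite exprn_gt0 ?normr_gt0.
set u := x - (ip y x / `|y| ^+ 2) *: y.
have yu : ip y u = 0.
  by rewrite /u ipBr ipZr ip_norm divfK ?subrr ?lt0r_neq0.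
have : 0 <= ip x u.
  have -> : ip x u = ip u u by rewrite {1}/u ipBl ipZl yu mulr0 subr0.
  by rewrite ip_norm exprn_ge0.
rewrite /u ipBr ipZr ip_norm (ip_hermitian y x).
rewrite subr_ge0 mulrAC [_^* * _]mulrC -normCK ler_pdivrMr //.
by rewrite -exprMn ler_pXn2r ?nnegrE ?mulr_ge0.
Qed.

End InnerProduct.

(** * Riesz representation of bounded functionals *)

(* The Riesz vector is the minimizer of q; an x with q x < inf q + d almost
   satisfies the Euler equation, and any two such x are close to each other. *)
Section Riesz.
Context {R : realType} {H : hilbertType R}.
Variables (phi : H -> R[i]) (K : R[i]).
Hypothesis phi_linear : forall (a : R[i]) x y,
  phi (a *: x + y) = a * phi x + phi y.
Hypothesis phi_bounded : forall x, `|phi x| <= K * `|x|.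

(** If [z] represents [phi], then [q x] is |x - z|^2 - |z|^2, so minimizing [q] finds [z]. *)
Let q (x : H) : R[i] := `|x| ^+ 2 - phi x - (phi x)^*.

Let q_real x : q x = (complex.Re (q x))%:C%C.
Proof.
apply/eqP; rewrite eq_sym; apply/eqP/RRe_real.
rewrite /q -addrA -opprD addcJ; apply: realB; first exact/realX/normr_real.
by apply: realM; [exact: realn | rewrite complex_real].
Qed.

Let phiD x y : phi (x + y) = phi x + phi y.
Proof. by rewrite -[x in LHS]scale1r phi_linear mul1r. Qed.

Let phi0 : phi 0 = 0.
Proof. by apply: (addrI (phi 0)); rewrite -phiD !addr0. Qed.

Let phiZ a x : phi (a *: x) = a * phi x.
Proof. by rewrite -[a *: x]addr0 phi_linear phi0 addr0. Qed.

Let q_ge x : - (`|K| ^+ 2) <= q x.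
Proof.
have h : phi x + (phi x)^* <= 2 * (`|K| * `|x|).
  rewrite addcJ ler_pM2l ?ltr0n //.
  apply: (@le_trans _ _ `|phi x|).
    by apply: le_trans (normc_ge_Re _); rewrite lecR ler_norm.
  apply: le_trans (phi_bounded x) _.
  (* [K] is a complex scalar of which only the product with a norm is known to be nonnegative; hence
     the passage to |K|. *)
  have : 0 <= K * `|x| by apply: le_trans (phi_bounded x).
  by move/ger0_norm <-; rewrite normrM normr_id.
rewrite /q -addrA -opprD.
apply: (@le_trans _ _ (`|x| ^+ 2 - 2 * (`|K| * `|x|))).
  rewrite -subr_ge0.
  have -> : `|x| ^+ 2 - 2 * (`|K| * `|x|) - - `|K| ^+ 2 = (`|x| - `|K|) ^+ 2.
    by rewrite sqrrB; ring.
  by rewrite real_exprn_even_ge0 // rpredB ?normr_real.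
by rewrite lerD2l lerN2.
Qed.

Let almost_min (d : R[i]) : 0 < d -> exists x, forall z, q x < q z + d.
Proof.
move=> d0.
have i0 : has_inf [set complex.Re (q x) | x in setT].
  split; first by exists (complex.Re (q 0)), 0.
  exists (- complex.Re (`|K| ^+ 2)) => _ [x _ <-].
  by have := q_ge x; rewrite lecE => /andP[_]; rewrite raddfN.
have dE : d = (complex.Re d)%:C%C by rewrite RRe_real // gtr0_real.
have d0' : 0 < complex.Re d by rewrite -ltcR -dE.
have [_ [x _ <-] ltx] := inf_adherent d0' i0.
exists x => z; rewrite (q_real x) (q_real z) dE -rmorphD ltcR.
apply: lt_le_trans ltx _; rewrite lerD2r; apply: ge_inf; first exact: i0.2.
by exists z.
Qed.

(** Parallelogram law: at the midpoint, [q] lies below the mean of [q x] and [q y] by |x - y|^2 / 4,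
    yet it cannot fall more than [d] below either value. *)
Let almost_min_dist (d : R[i]) x y : (forall z, q x < q z + d) ->
  (forall z, q y < q z + d) -> `|x - y| ^+ 2 <= 4 * d.
Proof.
move=> /(_ (2^-1 *: (x + y))) qx /(_ (2^-1 *: (x + y))) qy.
have : q x + q y < q (2^-1 *: (x + y)) + d + (q (2^-1 *: (x + y)) + d).
  exact: ltrD.
have -> : q (2^-1 *: (x + y)) + d + (q (2^-1 *: (x + y)) + d) =
    q x + q y - 2^-1 * `|x - y| ^+ 2 + 2 * d.
  rewrite /q phiZ phiD -!ip_norm ipZr ipZl !ipDr !ipDl !ipNr !ipNl.
  rewrite !rmorphM !rmorphD /= fmorphV rmorph_nat.
  by field.
rewrite -[X in _ < X]addrA ltrDl addrC subr_gt0 => /ltW.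
by rewrite ler_pdivrMl ?ltr0n // mulrA -natrM.
Qed.

Let almost_min_grad (d : R[i]) x u : 0 < d -> (forall z, q x < q z + d) ->
  `|ip x u - phi u| ^+ 2 <= d * `|u| ^+ 2.
Proof.
move=> d0 qx; have [->|u0] := eqVneq u 0.
  by rewrite ip0r phi0 subr0 !normr0 expr0n mulr0.
have nu : 0 < `|u| ^+ 2 by rewrite exprn_gt0 ?normr_gt0.
pose w : R[i] := ip x u - phi u.
have wE : w^* = ip u x - (phi u)^* by rewrite rmorphB /= -ip_hermitian.
(* This [a] minimizes [q] on the complex line through [x] in direction [u]; the gain is |w|^2 /
   |u|^2, which must stay below [d]. *)
pose a : R[i] := - (w^* / `|u| ^+ 2).
have aE : a^* = - (w / `|u| ^+ 2).
  rewrite rmorphN fmorph_div /= conjCK.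
  by rewrite -[X in X^*]ip_norm -ip_hermitian ip_norm.
have := qx (a *: u + x).
have -> : q (a *: u + x) = q x - `|w| ^+ 2 / `|u| ^+ 2.
  rewrite normCK /q phi_linear -[`|_ *: u + x| ^+ 2]ip_norm.
  have -> : (a * phi u + phi x)^* = a^* * (phi u)^* + (phi x)^*.
    by rewrite rmorphD rmorphM.
  rewrite ipDr !ipDl !ipZr !ipZl !ip_norm aE /a wE /w; field.
  by rewrite normr_eq0.
rewrite -[X in _ < X]addrA ltrDl addrC subr_gt0 => /ltW.
by rewrite ler_pdivrMr.
Qed.

Lemma riesz : exists z, forall u, phi u = ip z u.
Proof.
(* The square makes both error estimates linear in 1/(n+1): almost-minimizers from index n on are
   within 2/(n+1) of [y n]. *)
pose d n : R[i] := n.+1%:R^-1 ^+ 2.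
have d0 n : 0 < d n by rewrite exprn_gt0 ?invr_gt0 ?ltr0n.
have [y yP] := choice (fun n => almost_min (d0 n)).
have small (e : R[i]) : 0 < e -> \forall n \near \oo, n.+1%:R^-1 < e.
  move=> e0; have eE : e = (complex.Re e)%:C%C by rewrite RRe_real // gtr0_real.
  have e0' : 0 < complex.Re e by rewrite -ltcR -eE.
  apply: filterS (near_infty_natSinv_lt (PosNum e0')) => n /= ne.
  by rewrite eE -(rmorph_nat (real_complex R)) -fmorphV ltcR.
have yc : cvg (y n @[n --> \oo]).
  apply/cauchy_cvgP/cauchy_exP => e e0.
  have [N _ /(_ N (leqnn N)) /= Ne] := small (e / 2) (divr_gt0 e0 (ltr0Sn _ 1)).
  exists (y N), N => // n /= Nn; rewrite -ball_normE /=.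
  apply: le_lt_trans (_ : 2 * N.+1%:R^-1 < e); last first.
    by rewrite mulrC -ltr_pdivlMr.
  rewrite -(ler_pXn2r (ltn0Sn 1)) ?nnegrE ?mulr_ge0 ?invr_ge0 //.
  rewrite exprMn -natrX; apply: almost_min_dist; first exact: yP.
  move=> z; apply: lt_le_trans (yP n z) _.
  rewrite lerD2l ler_pXn2r ?nnegrE ?invr_ge0 //.
  by rewrite lef_pV2 ?posrE ?ltr0n // ler_nat ltnS.
exists (lim (y n @[n --> \oo])) => u; set z := lim _.
apply/subr0_eq/eqP; rewrite -normr_eq0; apply/negPn/negP => c0.
have u0 : 0 < `|u|.
  rewrite normr_gt0; apply: contraNneq c0 => ->.
  by rewrite ip0r phi0 subrr normr0.
(* Half of the supposed gap, divided by |u|: the Euler error and the distance to the limit each use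
   up less than one half. *)
have c1 : 0 < `|phi u - ip z u| / `|u| / 2.
  by rewrite !divr_gt0 // normr_gt0 -normr_eq0.
have [N _ /(_ N (leqnn N)) [Ne zN]] :=
  filterI (small _ c1) (proj1 (cvgrPdist_lt _ _) yc _ c1).
have : `|phi u - ip z u| < `|phi u - ip z u|; last by rewrite ltxx.
rewrite -{1}(subrK (ip (y N) u) (phi u)) -addrA -ipBl.
apply: le_lt_trans (ler_normD _ _) _.
rewrite [ltRHS]splitr; apply: ltrD.
  apply: (@le_lt_trans _ _ (N.+1%:R^-1 * `|u|)); last first.
    by rewrite -ltr_pdivlMr // mulrAC.
  rewrite distrC -(ler_pXn2r (ltn0Sn 1)) ?nnegrE ?mulr_ge0 ?invr_ge0 //.
  by rewrite exprMn; apply: almost_min_grad => //; exact: yP.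
apply: le_lt_trans (cauchy_schwarz _ _) _.
by rewrite -ltr_pdivlMr // mulrAC distrC.
Qed.

End Riesz.

(** * Bounded operators, generated von Neumann algebras, self-adjoint operators *)

Section Operators.
Context {R : realType} {H : hilbertType R}.
Implicit Types (A B : H -> H) (N : set (H -> H)) (T : operator H).

Lemma bounded_operatorB A B :
  bounded_operator A -> bounded_operator B -> bounded_operator (A \- B).
Proof.
move=> [lA cA] [lB cB]; split; last by move=> x; exact: cvgB (cA x) (cB x).
by move=> a x y /=; rewrite lA lB scalerBr opprD addrACA.
Qed.

Lemma bounded_operator_comp A B :
  bounded_operator A -> bounded_operator B -> bounded_operator (A \o B).
Proof.
move=> [lA cA] [lB cB]; split; first by move=> a x y /=; rewrite lB lA.
by move=> x; apply: continuous_comp; [exact: cB | exact: cA].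
Qed.

Lemma bounded_operator_bound A : bounded_operator A ->
  exists K : R[i], forall x, `|A x| <= K * `|x|.
Proof.
move=> [lA cA].
pose L : {linear H -> H} := HB.pack A (GRing.isLinear.Build _ _ _ _ A lA).
have /linear_boundedP bL : bounded_near L (nbhs 0).
  by apply/linear_bounded_continuous => x; exact: cA.
near +oo_(R[i]) => K.
by exists K; near: K; apply: bL.
Unshelve. all: by end_near. Qed.

(** [badj] is chosen by [get], so its defining property holds once Riesz representation supplies a
    candidate. *)
Lemma badjP A : bounded_operator A -> forall x y, ip x (A y) = ip (badj A x) y.
Proof.
move=> bA x y; have [K AK] := bounded_operator_bound bA.
have [lA _] := bA.
have [z zP] : exists z, forall u, ip x (A u) = ip z u.
  apply: (@riesz _ _ (fun u => ip x (A u)) (`|x| * K)) => [a u v|u].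
    by rewrite lA ipDr ipZr.
  apply: le_trans (cauchy_schwarz _ _) _.
  by rewrite -mulrA ler_wpM2l.
rewrite /badj /adjoint /=.
have := @getPex _ [set z | forall y, [set: H] y -> ip x (A y) = ip z y].
by apply; first by exists z => u _.
Qed.

Lemma badjE A B : bounded_operator A -> (forall x y, ip x (A y) = ip (B x) y) ->
  badj A = B.
Proof.
by move=> bA AB; apply/funext => x; apply: ip_ext => y; rewrite -badjP.
Qed.

Lemma vN_generated_bounded N A : vN_generated N A -> bounded_operator A.
Proof. by case. Qed.

Lemma vN_generated_id N : vN_generated N id.
Proof.
split; last by move=> A _; apply/funext.
by split=> // x; exact: cvg_id.
Qed.

Lemma vN_generated_comp N A B :
  vN_generated N A -> vN_generated N B -> vN_generated N (A \o B).
Proof.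
move=> [bA cA] [bB cB]; split; first exact: bounded_operator_comp.
by move=> C NC; rewrite compA cA // -compA cB.
Qed.

Lemma vN_generatedB N A B :
  vN_generated N A -> vN_generated N B -> vN_generated N (A \- B).
Proof.
move=> [bA cA] [bB cB]; split; first exact: bounded_operatorB.
move=> C NC; apply/funext => x /=.
have CA := congr1 (fun f => f x) (cA _ NC).
have CB := congr1 (fun f => f x) (cB _ NC).
have [[lC _] _] := NC.
rewrite /= in CA CB; rewrite -CA -CB.
pose L : {linear H -> H} := HB.pack C (GRing.isLinear.Build _ _ _ _ C lC).
exact: (raddfB L).
Qed.

(** A [y] in [D] closer to [x] than |x| would give |x|^2 = (x, x - y) < |x|^2. *)
Lemma dense_ip_eq0 (D : set H) x :
  dense D -> (forall y, D y -> ip x y = 0) -> x = 0.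
Proof.
move=> dD Dx; apply/eqP; rewrite -normr_eq0; apply/negPn/negP => x0.
have x1 : 0 < `|x| by rewrite normr_gt0 -normr_eq0.
have : ball x `|x| !=set0 by exists x; exact: ballxx.
move=> /dD /(_ (ball_open _ _)) [y []]; rewrite -ball_normE /= => xy Dy.
have := cauchy_schwarz x (x - y).
rewrite ipBr (Dx y Dy) subr0 ip_norm normrX normr_id expr2 ler_pM2l //.
by move=> /le_lt_trans /(_ xy); rewrite ltxx.
Qed.

Lemma selfadjoint_sym T x y : positive_selfadjoint T -> dom T x -> dom T y ->
  ip x (T y) = ip (T x) y.
Proof.
move=> [_ _ gT _] Tx Ty.
have [[z zP] /= ->] : graph (adjoint T) (x, T x) by rewrite gT.
have := @getPex _ [set z | forall y, dom T y -> ip x (T y) = ip z y].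
by apply; first by exists z.
Qed.

(** Equality of the graphs of [T] and [adjoint T] puts [x] in the domain; density of [dom T] makes
    the adjoint value unique, hence equal to [z]. *)
Lemma selfadjoint_mem T x z : positive_selfadjoint T ->
  (forall y, dom T y -> ip x (T y) = ip z y) -> dom T x /\ T x = z.
Proof.
move=> [_ dT gT _] xz.
have Ex : exists z, forall y, dom T y -> ip x (T y) = ip z y by exists z.
have : graph (adjoint T) (x, adjoint T x) by split.
rewrite gT => -[/= Tx Tx']; split=> //.
rewrite -Tx'; apply/subr0_eq/(dense_ip_eq0 dT) => y Ty; rewrite ipBl -xz //.
have := @getPex _ [set z | forall y, dom T y -> ip x (T y) = ip z y] Ex.
by move=> /(_ y Ty) ->; rewrite subrr.
Qed.

Lemma positive_sqrtP T Q x : positive_sqrt T Q -> dom T x ->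
  [/\ dom Q x, dom Q (Q x) & T x = Q (Q x)].
Proof.
move=> [_ gQ] Tx; have : graph T (x, T x) by split.
by rewrite -gQ => -[/= []].
Qed.

End Operators.

(** * Modular theory and the Hoelder inequality for Delta^(1/4) *)

Section Modular.
Context {R : realType} {H : hilbertType R}.
Variables (G : set (H -> H)) (Omega : H) (J : H -> H).
Variables (Delta D2 D4 : operator H).
Local Notation N := (vN_generated G).
Implicit Types A B C : H -> H.
Hypothesis N_adj : forall A, N A -> N (badj A).
Hypothesis modular : modular_objects N Omega J Delta D2 D4.
Hypothesis J_commutant : forall B, N B -> commutant N (J \o B \o J).

Let JK x : J (J x) = x. Proof. by case: modular => -[]. Qed.
Let ipJ x y : ip (J x) y = ip (J y) x.
Proof. by case: modular => -[_ ipJ _] *; rewrite -{1}[y]JK ipJ. Qed.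
Let D2_sa : positive_selfadjoint D2.
Proof. by case: modular => _ _ []. Qed.
Let D4_sqrt : positive_sqrt D2 D4.
Proof. by case: modular. Qed.

Let N_ip A x y : N A -> ip x (A y) = ip (badj A x) y.
Proof. by move=> /vN_generated_bounded/badjP ->. Qed.

Let N_ipl A x y : N A -> ip (A x) y = ip x (badj A y).
Proof. by move=> NA; rewrite ip_hermitian N_ip // -ip_hermitian. Qed.

Let N_badj_comp A B : N A -> N B -> badj (badj A \o B) = badj B \o A.
Proof.
move=> NA NB; apply: badjE => [|x y].
  exact: vN_generated_bounded (vN_generated_comp (N_adj NA) NB).
by rewrite /= -N_ipl // N_ip.
Qed.

(** The Tomita operator sends A Omega to A^* Omega and equals J Delta^(1/2); apply the involution
    [J]. *)
Lemma modular_core A : N A ->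
  dom D2 (A Omega) /\ D2 (A Omega) = J (badj A Omega).
Proof.
move=> NA; have [_ _ _ _ gS] := modular.
have : tomita_graph N Omega (A Omega, badj A Omega).
  by apply: subset_closure; exists A.
by rewrite gS => -[/= [D2A _]] ->; rewrite JK.
Qed.

(* On [N Omega] the hypothesis reads (v, psi) = (S psi, v), where
   S = J Delta^(1/2); it extends to the closure. *)
Lemma modular_real_vector v :
  (forall A, N A -> ip v (A Omega) = ip (badj A Omega) v) ->
  dom D2 (J v) /\ D2 (J v) = v.
Proof.
(* Self-adjointness of [D2] leaves [ip (J v) (D2 y) = ip v y], which by antiunitarity of [J] says (S
   y, v) = (v, y). *)
move=> vN; apply: selfadjoint_mem => // y D2y.
rewrite ipJ; have [_ _ _ _ gS] := modular.
have : tomita_graph N Omega (y, J (D2 y)) by rewrite gS; split.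
move: (J (D2 y)) => s cl.
apply/eqP; rewrite eq_sym -subr_eq0 -normr_eq0; apply/negPn/negP => n0.
have v0 : 0 < `|v|.
  rewrite normr_gt0; apply: contraNneq n0 => ->.
  by rewrite ip0l ip0r subrr normr0.
pose e := `|ip v y - ip s v| / `|v| / 2.
have e0 : 0 < e by rewrite !divr_gt0 // normr_gt0 -normr_eq0.
have [_ [[A NA <-] []]] := cl _ (nbhsx_ballx (y, s) e e0).
rewrite -!ball_normE /= => yA sA.
have : `|ip v y - ip s v| < `|ip v y - ip s v|; last by rewrite ltxx.
have {1}-> : ip v y - ip s v = ip v (y - A Omega) - ip (s - badj A Omega) v.
  by rewrite ipBr ipBl vN // opprB addrA subrK.
apply: le_lt_trans (ler_normB _ _) _; rewrite [ltRHS]splitr.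
apply: ltrD; apply: le_lt_trans (cauchy_schwarz _ _) _.
  by rewrite mulrC -ltr_pdivlMr // mulrAC.
by rewrite -ltr_pdivlMr // mulrAC.
Qed.

(** Delta^(1/2) exchanges Omega and J Omega, so it maps their difference to its negative; positivity
    forces that difference to vanish. *)
Lemma modular_conj_vacuum : J Omega = Omega.
Proof.
have id_adj : badj (id : H -> H) = id.
  by apply: badjE => //; exact: vN_generated_bounded (vN_generated_id G).
have [D2O D2OE] : dom D2 Omega /\ D2 Omega = J Omega.
  by have := modular_core (vN_generated_id G); rewrite id_adj.
have [D2J D2JE] : dom D2 (J Omega) /\ D2 (J Omega) = Omega.
  by apply: modular_real_vector => A NA; rewrite N_ip.
have [[[D20 D2D] D2lin] _ _ D2_ge0] := D2_sa.
have D2u := D2D (-1) _ _ D2O D2J.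
have := D2_ge0 _ D2u; rewrite D2lin // D2OE D2JE !scaleN1r.
have -> : - J Omega + Omega = - (- Omega + J Omega).
  by rewrite opprD opprK addrC.
rewrite ipNr ip_norm oppr_ge0 => le0.
have : `|- Omega + J Omega| ^+ 2 == 0 by rewrite eq_le le0 exprn_ge0.
by rewrite sqrf_eq0 normr_eq0 addrC subr_eq0 => /eqP.
Qed.

(* The left side is (C^* B Omega, Delta^(1/2) C^* B Omega), and
   Delta^(1/2) C^* B Omega = J B^* C Omega = (J B^* J) (J C J) Omega with the
   two factors in the commutant. *)
Lemma quarter_norm B C : N B -> N C ->
  `|D4 (badj C (B Omega))| ^+ 2 =
  ip (B (J (B Omega))) (C (J (C Omega))).
Proof.
move=> NB NC; have NP := vN_generated_comp (N_adj NC) NB.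
have [D2P D2PE] := modular_core NP.
have [D4P D4P' D24] := positive_sqrtP D4_sqrt D2P.
rewrite -ip_norm -selfadjoint_sym //; last by case: D4_sqrt.
rewrite /= in D24 D2PE *; rewrite -D24 D2PE N_badj_comp //=.
have comm A A' x : N A -> N A' -> A (J (A' (J x))) = J (A' (J (A x))).
  move=> NA NA'; have [_ /(_ A NA) /(congr1 (fun f => f x))] := J_commutant NA'.
  by rewrite /=.
(* Inserting [J] twice puts [badj B] between two [J]'s, where [C] commutes with it. *)
have -> : J (badj B (C Omega)) = J (badj B (J (J (C (J Omega))))).
  by rewrite JK modular_conj_vacuum.
rewrite -N_ip // comm //; last exact: N_adj.
rewrite -{1}[B Omega]JK ipJ JK -N_ip //.
by rewrite ipJ -(comm B B) // modular_conj_vacuum.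
Qed.

Let quarter_norm_diag B : N B -> `|D4 (badj B (B Omega))| = `|B (J (B Omega))|.
Proof.
move=> NB; apply/eqP; rewrite -(@eqrXn2 _ 2) //.
by rewrite quarter_norm // ip_norm.
Qed.

(** Cauchy-Schwarz for the vectors B J B Omega and C J C Omega, whose inner product and norms
    [quarter_norm] computes. *)
Lemma quarter_holder B C : N B -> N C ->
  `|D4 (badj C (B Omega))| ^+ 2 <=
  `|D4 (badj B (B Omega))| * `|D4 (badj C (C Omega))|.
Proof.
move=> NB NC; rewrite !quarter_norm_diag //.
apply: le_trans (cauchy_schwarz _ _).
by rewrite -quarter_norm // ger0_norm ?exprn_ge0.
Qed.

Lemma L4preE B :
  ((L4pre Omega D4 B) ^+ 2)%:C%C = `|D4 (badj B (B Omega))|.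
Proof.
have n0 : 0 <= `|D4 (badj B (B Omega))| by [].
rewrite /L4pre sqr_sqrtr; first by rewrite RRe_real // normr_real.
by move: n0; rewrite lecE => /andP[].
Qed.

Lemma L4pre_holder B C : N B -> N C ->
  `|D4 (badj C (B Omega))| <= (L4pre Omega D4 B * L4pre Omega D4 C)%:C%C.
Proof.
move=> NB NC; rewrite -(ler_pXn2r (ltn0Sn 1)) ?nnegrE //; last first.
  by rewrite ler0c mulr_ge0 // sqrtr_ge0.
apply: le_trans (quarter_holder NB NC) _.
by rewrite -!L4preE -rmorphM -exprMn rmorphXn.
Qed.

(** * L^4 bounds for a symmetric operator affiliated with the commutant *)

Section SymmetricForm.
Variable T : operator H.
Hypothesis T_sym : symmetric_operator T.
Hypothesis T_Omega : dom T Omega.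
Hypothesis T_affil : forall A, N A ->
  forall x, dom T x -> dom T (A x) /\ A (T x) = T (A x).

Lemma symmetric_form_bound : exists2 c : R, 0 <= c &
  forall B C, N B -> N C -> `|ip (B Omega) (T (C Omega))| <=
    (c * (L4pre Omega D4 B * L4pre Omega D4 C))%:C%C.
Proof.
have [D2J D2JE] : dom D2 (J (T Omega)) /\ D2 (J (T Omega)) = T Omega.
  apply: modular_real_vector => A NA.
  have [TA TAE] := T_affil NA T_Omega.
  by rewrite -T_sym // -TAE N_ip.
have [D4J D4J' D24] := positive_sqrtP D4_sqrt D2J.
(* Now [D4 eta] is [T Omega], and the norm of [eta] serves as the constant. *)
pose eta := D4 (J (T Omega)).
have etaE : `|eta| = (complex.Re `|eta|)%:C%C by rewrite RRe_real // normr_real.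
exists (complex.Re `|eta|); first by rewrite -ler0c -etaE.
move=> B C NB NC; have [_ <-] := T_affil NC T_Omega.
rewrite N_ip // -D2JE D24.
have [D2P _] := modular_core (vN_generated_comp (N_adj NC) NB).
have [D4P _ _] := positive_sqrtP D4_sqrt D2P.
rewrite selfadjoint_sym //; last by case: D4_sqrt.
apply: le_trans (cauchy_schwarz _ _) _.
by rewrite rmorphM /= -etaE mulrC ler_wpM2l // L4pre_holder.
Qed.

(* For an approximating sequence (A_k Omega) of x, the form at x is the iterated
   limit of (A_m Omega, T A_k Omega): T acts only on [N Omega] and on x. *)
Lemma symmetric_form_L4_bound : exists c : R, forall x r, dom T x ->
  L4_limit N Omega D4 x r -> `|ip x (T x)| <= (c * r ^+ 2)%:C%C.
Proof.
have [c c0 cP] := symmetric_form_bound.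
exists c => x r Tx [A [NA cauchyA Ax Ar]].
pose nr (y : H) := complex.Re `|y|.
have nrE y : `|y| = (nr y)%:C%C by rewrite RRe_real // normr_real.
have Ax0 : nr (x - A m Omega) @[m --> \oo] --> 0.
  apply/cvgrPdist_lt => e e0; have e0' : 0 < e%:C%C by rewrite (ltcR 0 e).
  apply: filterS (proj1 (cvgrPdist_lt _ _) Ax _ e0') => m.
  rewrite nrE ltcR sub0r normrN ger0_norm //.
  by rewrite -ler0c -nrE.
pose a := complex.Re `|ip x (T x)|.
have aE : `|ip x (T x)| = a%:C%C by rewrite RRe_real // normr_real.
pose Nm k := L4pre Omega D4 (A k).
have key e m0 : (forall m k, (m0 <= m)%N -> (m0 <= k)%N ->
    L4pre Omega D4 (A m \- A k) < e) ->
    forall k m, (m0 <= k)%N -> (m0 <= m)%N ->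
    a <= nr (T x) * nr (x - A k Omega) + nr (x - A m Omega) * nr (T (A k Omega))
       + c * (e * Nm k) + c * (Nm k * Nm k).
  move=> eP k m mk mm; have [TA _] := T_affil (NA k) T_Omega.
  rewrite -lecR -aE.
  (* Telescoping: the first two terms are controlled by convergence in [H], the third by the
     L^4-Cauchy condition through [cP], the last by [cP] alone. *)
  have -> : ip x (T x) = ip (T x) (x - A k Omega)
      + ip (x - A m Omega) (T (A k Omega))
      + ip ((A m \- A k) Omega) (T (A k Omega))
      + ip (A k Omega) (T (A k Omega)).
    rewrite ipBr !ipBl -!T_sym //; ring.
  rewrite !rmorphD.
  have NB := vN_generatedB (NA m) (NA k).
  apply: le_trans (ler_normD _ _) _; apply: lerD; last exact: cP.
  apply: le_trans (ler_normD _ _) _; apply: lerD; last first.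
    apply: le_trans (cP _ _ NB (NA k)) _; rewrite lecR ler_wpM2l //.
    by rewrite ler_wpM2r ?sqrtr_ge0 // ltW // eP.
  apply: le_trans (ler_normD _ _) _.
  by apply: lerD; rewrite rmorphM /= -!nrE cauchy_schwarz.
(* The limit in m comes first, with k fixed, because the norms of [T (A k Omega)] carry no uniform
   bound. *)
have key2 e : 0 < e -> a <= c * (e * r) + c * (r * r).
  move=> e0; have [m0 eP] := cauchyA e e0.
  have key1 k : (m0 <= k)%N ->
     a <= nr (T x) * nr (x - A k Omega) + c * (e * Nm k) + c * (Nm k * Nm k).
    move=> mk.
    have : nr (T x) * nr (x - A k Omega)
      + nr (x - A m Omega) * nr (T (A k Omega))
      + c * (e * Nm k) + c * (Nm k * Nm k) @[m --> \oo] -->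
      nr (T x) * nr (x - A k Omega) + 0 * nr (T (A k Omega))
      + c * (e * Nm k) + c * (Nm k * Nm k).
      do 2 (apply: cvgD; last exact: cvg_cst).
      by apply: cvgD; [exact: cvg_cst | apply: cvgM => //; exact: cvg_cst].
    rewrite mul0r addr0 => lim; apply: ler_cvg_to (cvg_cst a) lim _.
    by exists m0 => // m /= mm; exact: key eP _ _ mk mm.
  have : nr (T x) * nr (x - A k Omega) + c * (e * Nm k) + c * (Nm k * Nm k)
      @[k --> \oo] --> nr (T x) * 0 + c * (e * r) + c * (r * r).
    have ? : Nm k @[k --> \oo] --> r by [].
    apply: cvgD; last by apply: cvgM; [exact: cvg_cst | exact: cvgM].
    apply: cvgD; first by apply: cvgM => //; exact: cvg_cst.
    by apply: cvgM; [exact: cvg_cst | apply: cvgM => //; exact: cvg_cst].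
  rewrite mulr0 add0r => lim; apply: ler_cvg_to (cvg_cst a) lim _.
  by exists m0 => // k /= mk; exact: key1.
rewrite aE lecR expr2; apply/ler_addgt0Pr => d d0.
(* Adding 1 keeps the divisor positive when [c] or [r] vanishes. *)
have cr0 : 0 < c * `|r| + 1 by rewrite ltr_wpDl // mulr_ge0.
have := key2 (d / (c * `|r| + 1)) (divr_gt0 d0 cr0).
move=> /le_trans; apply; rewrite addrC lerD2l mulrCA mulrAC ler_pdivrMr //.
apply: ler_wpM2l; first exact: ltW.
by apply: le_trans (ler_wpM2l c0 (ler_norm r)) _; rewrite lerDl.
Qed.

End SymmetricForm.
End Modular.

(** * Transfer of the inequality between the two fields *)

(** The perturbation shifts each constant by at most [c]. Its reality turns the bound on the modulus
    into a two-sided bound in the order of R[i]. *)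
Lemma nontrivial_QI_perturb (R : realType) (H : hilbertType R) (B : set H)
    (nB : H -> R) (D : set H) (S S' : H -> H -> R[i]) (c : R) :
  (forall x, D x -> B x -> S x x - S' x x \is Num.real) ->
  (forall x, D x -> B x -> `|S x x - S' x x| <= (c * nB x ^+ 2)%:C%C) ->
  nontrivial_QI B nB D S -> nontrivial_QI B nB D S'.
Proof.
move=> dR dc [DB [b Sb] nS].
have bound x : D x ->
    (- c * nB x ^+ 2)%:C%C <= S x x - S' x x <= (c * nB x ^+ 2)%:C%C.
  move=> Dx; have := dc x Dx (DB x Dx).
  by rewrite real_ler_norml ?dR ?mulNr ?rmorphN //; exact: DB.
split=> //.
  exists (b - c) => x Dx; have /andP[_ le_c] := bound x Dx.
  rewrite mulrBl rmorphB lerBlDr; apply: le_trans (Sb x Dx) _.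
  by rewrite -lerBlDl.
move=> [a S'a]; apply: nS; exists (a + c) => x Dx.
have /andP[_ le_c] := bound x Dx.
rewrite mulrDl rmorphD -[S x x](subrK (S' x x)) addrC.
by apply: lerD => //; exact: S'a.
Qed.

Local Open Scope complex_scope.

Theorem theorem3p4 (R : realType) (n : nat) (M : topologicalType)
    (X : @static_spacetime R n M) (A : cstarType R) (H : hilbertType R)
    (T : thermal_setting X A H)
    (l h ht : (M -> R[i]) -> operator H) (Dsplit : set H)
    (f : M -> R[i]) (D : set H) :
  split_field T l h ht Dsplit ->
  test_function X f -> real_valued f ->
  Dsplit (Omega T) ->
  subspace_of D -> dense D ->
  D `<=` Dsplit `&` S_affil (vN T setT) (Omega T) (ht f) ->
  nontrivial_L4_QI T D (l f) <-> nontrivial_L4_QI T D (h f).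
Proof.
move=> [[_ [[[vN_alg _ _] _ _ _] _] [[_ _ _ ht_affil] ht_sym]]].
move=> [_ _ dom_split split_eq] f_test f_real D_Omega _ _ D_split.
(* Stability under adjoints comes from the net property contained in [h] being a quantum field for
   [vN T]. *)
have N_adj := (vN_alg setT openT).1.
have ht_dom x : Dsplit x -> dom (ht f) x.
  by move=> Dx; have [] := dom_split f f_test x Dx.
have symT := ht_sym f f_test f_real.
have J_commutant B : vN T setT B -> commutant (vN T setT) (J T \o B \o J T).
  by move=> NB; rewrite /vN -(tomita T); exists B.
have affil B : vN T setT B -> forall x, dom (ht f) x ->
    dom (ht f) (B x) /\ B (ht f x) = ht f (B x).
  (* Taking the whole spacetime as region, [ht f] is affiliated with an algebra inside
     [vN_tilde T setT], which Tomita's theorem identifies with the commutant of [vN T setT]; hence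
     [B] commutes with that algebra. *)
  move=> NB; have [_ ] := ht_affil f setT f_test openT (@subsetT _ _).
  apply; split; first exact: vN_generated_bounded NB.
  move=> C [_]; rewrite /vN_tilde /vN (tomita T) => -[_ /(_ B NB)].
  by move->.
have [c cP] := symmetric_form_L4_bound N_adj (modularP T) J_commutant symT
  (ht_dom _ D_Omega) affil.
have form_bound x : D x -> L4 (vN T setT) (Omega T) (Delta_quarter T) x ->
    `|form_of (ht f) x x| <=
    (c * L4norm (vN T setT) (Omega T) (Delta_quarter T) x ^+ 2)%:C.
  move=> Dx Lx; apply: cP; first by apply: ht_dom; have [] := D_split x Dx.
  (* The bound [cP] holds for every limit [r], in particular for the one that [get] selects in
     [L4norm]. *)
  exact: getPex Lx.
have form_real x : D x -> form_of (ht f) x x \is Num.real.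
  move=> Dx; have htx : dom (ht f) x by apply: ht_dom; have [] := D_split x Dx.
  by rewrite CrealE /form_of -ip_hermitian symT.
have form_split x : D x ->
    form_of (h f) x x - form_of (l f) x x = form_of (ht f) x x.
  move=> Dx; rewrite /form_of split_eq //; last by have [] := D_split x Dx.
  by rewrite opprB addrC subrK.
split; apply: nontrivial_QI_perturb => x Dx Lx.
- by rewrite -opprB form_split // rpredN form_real.
- by rewrite -opprB form_split // normrN; exact: form_bound.
- by rewrite form_split // form_real.
- by rewrite form_split //; exact: form_bound.
Qed.
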